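(* Let $N=(ST,suc,\{nei_a\}_{a\in AG},L)$ be a single-coalition-first neighborhood model with neighborhood functions $\{nei_C\}_{C\subseteq AG}$. The following two conditions are equivalent: (1) there is $r\in ST$ such that for every $a\in AG$ and $s\in ST$, there is a unique $\{a\}$-history from $r$ to $s$; (2) there is $r\in ST$ such that for every $C\subseteq AG$ and $s\in ST$, there is a unique $C$-history from $r$ to $s$.
   Context: $AG$ is a finite nonempty set of agents, $AP$ a countable set of atomic propositions. A single-coalition-first neighborhood model is $N=(ST,suc,\{nei_a\}_{a\in AG},L)$ with $ST$ nonempty, $suc:ST\to\mathcal P(ST)$, $L:ST\to\mathcal P(AP)$, and for all $a,s$, $nei_a(s)\subseteq\mathcal P(ST)$ a cover of $suc(s)$ (its union is $suc(s)$, $\emptyset\notin nei_a(s)$). For families of nonempty sets, $\Delta_1\odot\Delta_2=\{Y_1\cap Y_2\mid Y_1\in\Delta_1,Y_2\in\Delta_2,Y_1\cap Y_2\neq\emptyset\}$, extended to finitely many families ($\bigodot\{\Delta\}=\Delta$). Neighborhood functions: $nei_C(s)=\emptyset$ if $suc(s)=\emptyset$; $\{suc(s)\}$ if $suc(s)\neq\emptyset$ and $C=\emptyset$; $\bigodot\{nei_a(s)\mid a\in C\}$ otherwise. For $C\subseteq AG$, a $C$-history from $s_0$ to $s_n$ is either the one-element sequence $(s_0)$ (from $s_0$ to $s_0$) or a finite sequence $(s_0,Y_1,s_1,\dots,Y_n,s_n)$, $n\ge1$, of states $s_i$ and sets $Y_i\subseteq ST$ with $Y_{i+1}\in nei_C(s_i)$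 and $s_{i+1}\in Y_{i+1}$ for all $0\le i<n$. *)

(* Defs.v *)
From HB Require Import structures.
From mathcomp Require Import all_boot.
From mathcomp Require Import boolp classical_sets.

Set Implicit Arguments.
Unset Strict Implicit.
Unset Printing Implicit Defensive.

Local Open Scope classical_set_scope.

Definition is_cover (T : Type) (D : set (set T)) (A : set T) : Prop :=
  \bigcup_(Y in D) Y = A /\ ~ D set0.

Record scf_model (AG : finType) (AP : countType) := ScfModel {
  state : Type;
  state_inhabited : inhabited state;
  suc : state -> set state;
  nei1 : AG -> state -> set (set state);
  label : state -> set AP;
  nei1_cover : forall a s, is_cover (nei1 a s) (suc s)
}.

Definition odot (T : Type) (D1 D2 : set (set T)) : set (set T) :=
  [set Y | exists Y1 Y2,
     [/\ D1 Y1, D2 Y2, Y1 `&` Y2 !=set0 & Y = Y1 `&` Y2]].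

Lemma odotC (T : Type) : commutative (@odot T).
Proof.
suff H (D1 D2 : set (set T)) : odot D1 D2 `<=` odot D2 D1.
  by move=> D1 D2; apply/seteqP; split; apply: H.
move=> _ [Y1 [Y2 [H1 H2 H ->]]].
by exists Y2, Y1; split; rewrite // setIC.
Qed.

Lemma odotA (T : Type) : associative (@odot T).
Proof.
move=> D1 D2 D3; apply/seteqP; split.
- move=> _ [Y1 [_ [H1 [Y2 [Y3 [H2 H3 _ ->]]] H ->]]].
  rewrite setIA in H *; exists (Y1 `&` Y2), Y3; split=> //.
  by exists Y1, Y2; split=> //; case: H => x [? _]; exists x.
- move=> _ [_ [Y3 [[Y1 [Y2 [H1 H2 _ ->]]] H3 H ->]]].
  rewrite -setIA in H *; exists Y1, (Y2 `&` Y3); split=> //.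
  by exists Y2, Y3; split=> //; case: H => x [_ ?]; exists x.
Qed.

Lemma odot1 (T : Type) (D : set (set T)) :
  ~ D set0 -> odot D [set setT] = D.
Proof.
move=> D0; apply/seteqP; split.
- by move=> _ [Y [_ [HY -> _ ->]]]; rewrite setIT.
- move=> Y HY; exists Y, setT; rewrite setIT; split=> //.
  by apply/set0P/eqP => Y0; apply: D0; rewrite -Y0.
Qed.

(* The iterated product is indexed by the agents of [C]: two agents with equal
   neighborhoods still choose independently. On families of nonempty sets
   [set setT] is neutral for odot, so \bigodot{D} = D. *)
Definition nei (AG : finType) (AP : countType) (N : scf_model AG AP)
    (C : {set AG}) (s : state N) : set (set (state N)) :=
  if `[< suc s = set0 >] then set0
  else if C == finset.set0 then [set suc s]
  else \big[@odot (state N)/[set setT]]_(a in C) nei1 a s.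

Lemma nei_set1 (AG : finType) (AP : countType) (N : scf_model AG AP)
    (a : AG) (s : state N) :
  nei [set a]%SET s = nei1 a s.
Proof.
have [cov n0] := nei1_cover a s.
rewrite /nei; case: asboolP => [e|_].
  apply/seteqP; split=> // Y HY; apply: n0.
  suff <- : Y = set0 by [].
  by apply/seteqP; split=> // x Yx; rewrite -e -cov; exists Y.
rewrite ifN; last by apply/finset.set0Pn; exists a; rewrite finset.inE.
by rewrite big_set1E odot1.
Qed.

(* A history (s_0, Y_1, s_1, ..., Y_n, s_n) is encoded by its source s_0 and the
   sequence of pairs (Y_1, s_1), ..., (Y_n, s_n). *)
Fixpoint is_history (AG : finType) (AP : countType) (N : scf_model AG AP)
    (C : {set AG}) (s : state N) (h : seq (set (state N) * state N))
    (t : state N) : Prop :=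
  match h with
  | [::] => s = t
  | (Y, s') :: h' => [/\ nei C s Y, Y s' & is_history C s' h' t]
  end.

(* Main.v *)
Require Import Defs.
From mathcomp Require Import all_boot.
From mathcomp Require Import boolp classical_sets.

(** A [C]-history projects to a path of the relation [suc], because each
    [nei C s] covers [suc s]; conversely every [suc]-path lifts to a
    [C]-history. Unique [{a}]-histories from [r] make [suc]-paths from [r]
    unique, and force the members of each [nei1 a s] to be pairwise disjoint.
    Disjointness is preserved by [odot], so [nei C s] partitions [suc s] for
    every [C], and then the lift of a [suc]-path to a [C]-history is unique. *)

Section Odot.
Set Implicit Arguments.
Unset Strict Implicit.
Local Open Scope classical_set_scope.
Variable T : Type.
Implicit Types D : set (set T).

Definition pairwise_disjoint D : Prop :=
  forall Y Z x, D Y -> D Z -> Y x -> Z x -> Y = Z.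

Lemma pairwise_disjoint1 (A : set T) : pairwise_disjoint [set A].
Proof. by move=> Y Z x /= -> ->. Qed.

Lemma pairwise_disjoint_odot D1 D2 :
  pairwise_disjoint D1 -> pairwise_disjoint D2 -> pairwise_disjoint (odot D1 D2).
Proof.
move=> d1 d2 _ _ x [Y1 [Y2 [DY1 DY2 _ ->]]] [Z1 [Z2 [DZ1 DZ2 _ ->]]].
by move=> [Y1x Y2x] [Z1x Z2x]; rewrite (d1 Y1 Z1 x) // (d2 Y2 Z2 x).
Qed.

(** Dropping the empty intersections from [odot] loses no point of the union. *)
Lemma bigcup_odot D1 D2 :
  \bigcup_(Y in odot D1 D2) Y =
  (\bigcup_(Y in D1) Y) `&` (\bigcup_(Y in D2) Y).
Proof.
apply/seteqP; split=> x.
- by move=> [_ [Y1 [Y2 [D1Y D2Y _ ->]]] [Y1x Y2x]]; split; [exists Y1 | exists Y2].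
- move=> [[Y1 D1Y Y1x] [Y2 D2Y Y2x]]; exists (Y1 `&` Y2) => //.
  by exists Y1, Y2; split=> //; exists x.
Qed.

End Odot.

Section Histories.
Set Implicit Arguments.
Unset Strict Implicit.
Local Open Scope classical_set_scope.
Variables (AG : finType) (AP : countType) (N : scf_model AG AP).
Implicit Types (C : {set AG}) (s t : state N).
Implicit Types h : seq (set (state N) * state N).

(** By [bigcup_odot], each agent of [C] in [l] contributes a factor with union [suc s]. At least one
    must occur, since the empty product [[set setT]] has union [setT]. *)
Lemma bigcup_big_nei1 C s (l : seq AG) : has [in C] l ->
  \bigcup_(Y in \big[@odot (state N)/[set setT]]_(a <- l | a \in C) nei1 a s) Y
  = suc s.
Proof.
have cov a : \bigcup_(Y in nei1 a s) Y = suc s by case: (nei1_cover a s).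
elim: l => // a l IH /=; rewrite big_cons.
case: ifP => [_ _|_ /IH //]; rewrite bigcup_odot cov.
have [/IH ->|nCl] := boolP (has [in C] l); first by rewrite setIid.
(* No agent of [C] remains in the tail, so its product is the neutral [[set setT]]. *)
by rewrite big_hasC // bigcup_set1 setIT.
Qed.

Lemma bigcup_nei C s : \bigcup_(Y in nei C s) Y = suc s.
Proof.
rewrite /nei; case: asboolP => [->|_]; first by rewrite bigcup_set0.
case: ifPn => [_|/finset.set0Pn [a aC]]; first by rewrite bigcup_set1.
by apply: bigcup_big_nei1; apply/hasP; exists a; rewrite ?mem_index_enum.
Qed.

Lemma pairwise_disjoint_nei C s :
  (forall a, pairwise_disjoint (nei1 a s)) -> pairwise_disjoint (nei C s).
Proof.
move=> dis; rewrite /nei; case: asboolP => [_ Y Z x []|_].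
case: ifP => [_|_]; first exact: pairwise_disjoint1.
apply: big_ind => // [|D1 D2]; first exact: pairwise_disjoint1.
exact: pairwise_disjoint_odot.
Qed.

Lemma history_change_coalition C C' s h t : is_history C s h t ->
  exists2 h', is_history C' s h' t & map snd h' = map snd h.
Proof.
elim: h s => [|[Y s'] h IH] s /=; first by exists [::].
move=> [neiY Ys' /IH [h' hist' eq_h']].
have : (\bigcup_(Z in nei C' s) Z) s'.
  by rewrite bigcup_nei -(bigcup_nei C); exists Y.
by move=> [Z neiZ Zs']; exists ((Z, s') :: h'); rewrite //= eq_h'.
Qed.

(** Under disjointness, the states before and after a step determine the neighborhood chosen
    there. *)
Lemma history_inj_states C s h1 h2 t :
  (forall s', pairwise_disjoint (nei C s')) ->
  is_history C s h1 t -> is_history C s h2 t ->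
  map snd h1 = map snd h2 -> h1 = h2.
Proof.
move=> dis; elim: h1 h2 s => [|[Y1 s1] h1 IH] [|[Y2 s2] h2] s //=.
move=> [neiY1 Ys1 hist1] [neiY2 Ys2 hist2] [eq_s eq_h]; subst s2.
by rewrite (dis s Y1 Y2 s1) // (IH h2 s1).
Qed.

Lemma history_rcons C r h s Y t :
  is_history C r h s -> nei C s Y -> Y t -> is_history C r (rcons h (Y, t)) t.
Proof.
move=> + neiY Yt; elim: h r => [|[Z u] h IH] r /=; first by move=> ->.
by move=> [neiZ Zu /IH].
Qed.

(** Two members of [nei C s] sharing [x] extend a history from [r] to [s] into two histories to [x],
    which must coincide. Existence is used at [s], uniqueness at [x]. *)
Lemma unique_history_disjoint C r :
  (forall s, exists! h, is_history C r h s) ->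
  forall s, pairwise_disjoint (nei C s).
Proof.
move=> uniqC s Y Z x neiY neiZ Yx Zx.
have [h [hist_s _]] := uniqC s; have [g [_ g_uniq]] := uniqC x.
have eqY := g_uniq _ (history_rcons hist_s neiY Yx).
have := g_uniq _ (history_rcons hist_s neiZ Zx).
by rewrite eqY => /rcons_inj [].
Qed.

End Histories.

Theorem theorem6p8 (AG : finType) (AP : countType) (AG_nonempty : 0 < #|AG|)
    (N : scf_model AG AP) :
  (exists r : state N, forall (a : AG) (s : state N),
     exists! h, is_history [set a] r h s)
  <->
  (exists r : state N, forall (C : {set AG}) (s : state N),
     exists! h, is_history C r h s).
Proof.
split=> [[r uniq1]|[r uniqC]]; last by exists r => a; apply: uniqC.
(* The histories of this single agent supply a path to [s] and its uniqueness for every [C]. *)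
exists r => C s; have /card_gt0P [a _] := AG_nonempty.
have disC (s' : state N) : pairwise_disjoint (nei C s').
  apply: pairwise_disjoint_nei => b; rewrite -nei_set1.
  exact: (unique_history_disjoint (uniq1 b)).
have [g [hist_g g_uniq]] := uniq1 a s.
have [h hist_h eq_h] := history_change_coalition C hist_g.
exists h; split=> // h' hist_h'.
(* Sent back to a history of [[set a]], the competitor [h'] becomes [g], so [h'] and [h] visit the
   same states. *)
have [g' hist_g' eq_h'] := history_change_coalition [set a] hist_h'.
apply: (history_inj_states disC hist_h hist_h').
by rewrite eq_h (g_uniq g').
Qed.
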